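(* Let $S=(s_{ij})\in\mathbb{R}^{n\times n}$ be symmetric with zero diagonal and $\mu\in\mathbb{R}^n$. Let $H\subset\{1,\dots,n\}$, $Q=H^c$, and let $\mathbf{v}_H=(v_i)_{i\in H}\in\{-1,1\}^{|H|}$ be fixed signs on $H$. (i) Under the constraint that the spins on $H$ are fixed at $\mathbf{v}_H$, minimizing $E(\mathbf{v})=-\tfrac12\mathbf{v}^{\mathsf T}S\mathbf{v}-\mu\cdot\mathbf{v}$ over $\mathbf{v}\in\{-1,1\}^n$ is equivalent to minimizing $$E_Q(\mathbf{v}_Q)=-\tfrac12\mathbf{v}_Q^{\mathsf T}S_{QQ}\mathbf{v}_Q-\mu_{\mathrm{eff}}\cdot\mathbf{v}_Q,\qquad \mu_{\mathrm{eff}}=\mu_Q+S_{QH}\mathbf{v}_H,$$ over $\mathbf{v}_Q\in\{-1,1\}^{|Q|}$; that is, $\mathbf{v}_Q$ minimizes $E_Q$ if and only if $(\mathbf{v}_Q,\mathbf{v}_H)$ minimizes $E$ among all $\mathbf{v}\in\{-1,1\}^n$ whose restriction to $H$ is $\mathbf{v}_H$. (ii) Let $(\mathbf{x}^{(k)},\mathbf{y}^{(k)})$ be a bSB state at step $k$ (so $|x_j^{(k)}|\le1$ for all $j$). If $x_i^{(k)}=v_i$ and $y_i^{(k)}=0$ for every $i\in H$, and $$\rho_i(k;H)=(\alpha_k^2-1)+\mu_iv_i+\sum_{j\in H}s_{ij}v_iv_j-\sum_{j\in Q}|s_{ij}|>0\quad\text{for every } i\in H,$$ then one bSB clipped step (defined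 in the context) yields $x_i^{(k+1)}=v_i$ and $y_i^{(k+1)}=0$ for every $i\in H$.
   Context: $S_{QQ}$, $S_{QH}$, $\mu_Q$ denote the submatrices and subvector indexed by the sets shown. One bSB step with step size $\tau>0$ and parameter $\alpha_k\ge 0$ maps $(\mathbf{x}^{(k)},\mathbf{y}^{(k)})\in\mathbb{R}^n\times\mathbb{R}^n$ to $(\mathbf{x}^{(k+1)},\mathbf{y}^{(k+1)})$ as follows: for each $i$, $$\tilde y_i=y_i^{(k)}+\tau\big((\alpha_k^2-1)x_i^{(k)}+\mu_i+(S\mathbf{x}^{(k)})_i\big),\qquad \tilde x_i=x_i^{(k)}+\tau\tilde y_i;$$ if $|\tilde x_i|>1$ then $x_i^{(k+1)}=\operatorname{sgn}(\tilde x_i)$ and $y_i^{(k+1)}=0$; if $|\tilde x_i|\le1$ then $x_i^{(k+1)}=\tilde x_i$ and $y_i^{(k+1)}=\tilde y_i$. *)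

(* Defs.v *)
From mathcomp Require Import all_boot all_order all_algebra.
From mathcomp Require Import reals.

Set Implicit Arguments.
Unset Strict Implicit.
Unset Printing Implicit Defensive.

Import Order.TTheory GRing.Theory Num.Theory.
Local Open Scope ring_scope.

(* Vectors are columns.  A vector (v_i)_{i \in A}, for A : {set 'I_n}, is a
   'cV[R]_#|A|, whose entry k is the one attached to the index enum_val k of A
   (the k-th element of A in increasing order). *)

Definition subvec (R : Type) n (A : {set 'I_n}) (v : 'cV[R]_n) : 'cV[R]_#|A| :=
  rowsub (fun k : 'I_#|A| => enum_val k) v.

Definition submat (R : Type) n (A B : {set 'I_n}) (M : 'M[R]_n) :
    'M[R]_(#|A|, #|B|) :=
  mxsub (fun k : 'I_#|A| => enum_val k) (fun l : 'I_#|B| => enum_val l) M.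

Definition glue (R : Type) n (H : {set 'I_n})
    (vQ : 'cV[R]_#|~: H|) (vH : 'cV[R]_#|H|) : 'cV[R]_n :=
  \col_(i < n)
    match boolP (i \in H) with
    | AltTrue iH => vH (enum_rank_in iH i) 0
    | AltFalse iNH =>
        vQ (enum_rank_in (etrans (in_setC i H) iNH) i) 0
    end.

Lemma subvec_glueH (R : Type) n (H : {set 'I_n})
    (vQ : 'cV[R]_#|~: H|) (vH : 'cV[R]_#|H|) : subvec H (glue vQ vH) = vH.
Proof.
apply/matrixP=> k j; rewrite !mxE (ord1 j).
by case: {-}_ / boolP => [iH | /negP[]]; rewrite ?enum_valK_in ?enum_valP.
Qed.

Lemma subvec_glueQ (R : Type) n (H : {set 'I_n})
    (vQ : 'cV[R]_#|~: H|) (vH : 'cV[R]_#|H|) : subvec (~: H) (glue vQ vH) = vQ.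
Proof.
apply/matrixP=> k j; rewrite !mxE (ord1 j).
case: {-}_ / boolP => [iH | iNH]; last by rewrite enum_valK_in.
by have := enum_valP k; rewrite inE iH.
Qed.

Definition is_spin (R : pzRingType) m (v : 'cV[R]_m) : Prop :=
  forall i, v i 0 = -1 \/ v i 0 = 1.

Definition energy (R : realType) m (S : 'M[R]_m) (mu v : 'cV[R]_m) : R :=
  - (2^-1 * (v^T *m S *m v) 0 0) - (mu^T *m v) 0 0.

Definition mu_eff (R : realType) n (S : 'M[R]_n) (mu : 'cV[R]_n)
    (H : {set 'I_n}) (vH : 'cV[R]_#|H|) : 'cV[R]_#|~: H| :=
  subvec (~: H) mu + submat (~: H) H S *m vH.

Definition minimizes (R : realType) (T : Type) (D : T -> Prop) (f : T -> R)
    (v : T) : Prop :=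
  D v /\ forall w, D w -> f v <= f w.

Definition bSB_step (R : realType) n (S : 'M[R]_n) (mu : 'cV[R]_n)
    (tau alpha : R) (xy : 'cV[R]_n * 'cV[R]_n) : 'cV[R]_n * 'cV[R]_n :=
  let: (x, y) := xy in
  let yt := \col_(i < n) (y i 0 +
    tau * ((alpha ^+ 2 - 1) * x i 0 + mu i 0 + (S *m x) i 0)) in
  let xt := \col_(i < n) (x i 0 + tau * yt i 0) in
  (\col_(i < n) (if 1 < `|xt i 0| then Num.sg (xt i 0) else xt i 0),
   \col_(i < n) (if 1 < `|xt i 0| then 0 else yt i 0)).

Definition rho (R : realType) n (S : 'M[R]_n) (mu : 'cV[R]_n)
    (H : {set 'I_n}) (vH : 'cV[R]_#|H|) (alpha : R) (k : 'I_#|H|) : R :=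
  (alpha ^+ 2 - 1) + mu (enum_val k) 0 * vH k 0
  + \sum_(l < #|H|) S (enum_val k) (enum_val l) * vH k 0 * vH l 0
  - \sum_(j in ~: H) `|S (enum_val k) j|.

(* Main.v *)
(** (i) Expanding the quadratic form in blocks along H and its complement Q, the
    two cross terms agree by symmetry of S and contribute v_Q . (S_QH v_H), so E
    and E_Q differ by a term depending on v_H only.
    (ii) At a frozen spin i, multiplying the force by v_i gives at least
    rho_i > 0, since the spins in Q contribute at least - sum_Q |s_ij|.  Hence
    the tentative position is pushed outwards from v_i and is clipped back. *)

Require Import Defs.
From mathcomp Require Import all_boot all_order all_algebra.
From mathcomp Require Import reals.
From mathcomp Require Import ring lra.

Set Implicit Arguments.
Unset Strict Implicit.
Unset Printing Implicit Defensive.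

Import Order.TTheory GRing.Theory Num.Theory.
Local Open Scope ring_scope.

Lemma sum_split_setC (V : nmodType) n (H : {set 'I_n}) (F : 'I_n -> V) :
  \sum_i F i = \sum_(i in H) F i + \sum_(i in ~: H) F i.
Proof.
rewrite (bigID (mem H)) /=; congr (_ + _).
by apply: eq_bigl => i; rewrite inE.
Qed.

(** The inner sum splits along [H] and its complement, and [enum_val] reindexes each half by
    positions, giving the block products. *)
Lemma mulmx_split_setC (R : pzRingType) m n p (H : {set 'I_n})
    (A : 'M[R]_(m, n)) (B : 'M[R]_(n, p)) :
  A *m B = colsub (fun k : 'I_#|H| => enum_val k) A
             *m rowsub (fun k : 'I_#|H| => enum_val k) B
         + colsub (fun k : 'I_#|~: H| => enum_val k) A
             *m rowsub (fun k : 'I_#|~: H| => enum_val k) B.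
Proof.
apply/matrixP=> i j; rewrite !mxE (sum_split_setC H).
rewrite big_enum_val [X in _ + X = _]big_enum_val.
by congr (_ + _); apply: eq_bigr => k _; rewrite !mxE.
Qed.

Lemma trmx_mulmx_split_setC (R : pzRingType) n (H : {set 'I_n})
    (u v : 'cV[R]_n) :
  u^T *m v = (subvec H u)^T *m subvec H v
           + (subvec (~: H) u)^T *m subvec (~: H) v.
Proof. by rewrite (mulmx_split_setC H) -!trmx_mxsub. Qed.

Lemma subvec_mulmx (R : pzRingType) n (A H : {set 'I_n})
    (S : 'M[R]_n) (v : 'cV[R]_n) :
  subvec A (S *m v) = submat A H S *m subvec H v
                    + submat A (~: H) S *m subvec (~: H) v.
Proof.
rewrite /subvec -mul_rowsub_mx (mulmx_split_setC H).
by congr (_ + _); congr (_ *m _); apply/matrixP=> i j; rewrite !mxE.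
Qed.

Lemma trmx_submat (R : pzRingType) n (A B : {set 'I_n}) (S : 'M[R]_n) :
  S^T = S -> (submat A B S)^T = submat B A S.
Proof. by move=> S_sym; rewrite /submat trmx_mxsub S_sym. Qed.

Lemma tr_mx11 (R : Type) (A : 'M[R]_1) : A^T = A.
Proof. by apply/matrixP=> i j; rewrite mxE !ord1. Qed.

(** The two equal cross terms absorb the factor 1/2 and form the [S_QH v_H] part of [mu_eff]. What
    remains is the energy of the [H] block, constant once [vH] is fixed. *)
Lemma energy_split_setC (R : realType) n (S : 'M[R]_n) (mu v : 'cV[R]_n)
    (H : {set 'I_n}) (vH : 'cV[R]_#|H|) :
  S^T = S -> subvec H v = vH ->
  energy S mu v =
    energy (submat (~: H) (~: H) S) (mu_eff S mu vH) (subvec (~: H) v)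
    + energy (submat H H S) (subvec H mu) vH.
Proof.
move=> S_sym <-; rewrite /energy /mu_eff -!mulmxA.
rewrite !(trmx_mulmx_split_setC H) !(subvec_mulmx _ H).
set a := subvec H v; set b := subvec (~: H) v.
rewrite [(_ + _)^T]linearD /= trmx_mul trmx_submat // !mulmxDl !mulmxDr -!mulmxA.
(* A 1 x 1 matrix equals its transpose, and transposition swaps the off-diagonal blocks of the
   symmetric [S]. *)
have cross : b^T *m (submat (~: H) H S *m a) = a^T *m (submat H (~: H) S *m b).
  by rewrite -[LHS]tr_mx11 !trmx_mul trmxK trmx_submat // mulmxA.
rewrite ![(_ + _ : 'M_1) 0 0]mxE cross.
by field.
Qed.

Lemma subvec_spin (R : pzRingType) n (A : {set 'I_n}) (v : 'cV[R]_n) :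
  is_spin v -> is_spin (subvec A v).
Proof. by move=> v_spin k; rewrite mxE. Qed.

Lemma glue_spin (R : pzRingType) n (H : {set 'I_n})
    (vQ : 'cV[R]_#|~: H|) (vH : 'cV[R]_#|H|) :
  is_spin vQ -> is_spin vH -> is_spin (glue vQ vH).
Proof. by move=> vQ_spin vH_spin i; rewrite mxE; case: {-}_ / boolP. Qed.

(** Since v_k^2 = 1 and x agrees with [vH] on [H], all terms match exactly except the sum over the
    complement, where only |x_j| <= 1 is known. *)
Lemma rho_le_field (R : realType) n (S : 'M[R]_n) (mu x : 'cV[R]_n)
    (H : {set 'I_n}) (vH : 'cV[R]_#|H|) (alpha : R) (k : 'I_#|H|) :
  is_spin vH -> (forall j, `|x j 0| <= 1) -> subvec H x = vH ->
  rho S mu vH alpha k <=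
    vH k 0 * ((alpha ^+ 2 - 1) * vH k 0 + mu (enum_val k) 0
              + (S *m x) (enum_val k) 0).
Proof.
move=> vH_spin x_le1 xH.
have vv1 : vH k 0 * vH k 0 = 1 by case: (vH_spin k) => ->; ring.
have v_norm : `|vH k 0| = 1 by case: (vH_spin k) => ->; rewrite ?normrN normr1.
have vHE l : vH l 0 = x (enum_val l) 0 by rewrite -xH mxE.
rewrite /rho mxE (sum_split_setC H).
rewrite !mulrDr mulrCA vv1 mulr1 [vH k 0 * mu _ _]mulrC !addrA lerD //.
  rewrite lerD // [X in _ <= _ * X]big_enum_val mulr_sumr.
  by apply: ler_sum => l _; rewrite [vH l 0]vHE mulrA [S _ _ * _]mulrC.
(* Termwise, -(v_k s_kj x_j) <= |v_k| |s_kj| |x_j| <= |s_kj|. *)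
rewrite mulr_sumr -sumrN; apply: ler_sum => j _.
rewrite lerNl; apply: le_trans (ler_norm _) _.
by rewrite normrN !normrM v_norm mul1r ler_piMr.
Qed.

(** A displacement t with the sign of v leads away from the origin: |v + t| = 1 + |t|, and the sign
    is kept. *)
Lemma clip_spin (R : realType) (v t : R) :
  v = -1 \/ v = 1 -> 0 < v * t -> 1 < `|v + t| /\ Num.sg (v + t) = v.
Proof.
case=> ->; rewrite ?mulN1r ?mul1r => t_gt0.
  by rewrite ltr0_norm ?ltr0_sg; [split=> // | |]; lra.
by rewrite gtr0_norm ?gtr0_sg; [split=> // | |]; lra.
Qed.

Theorem theorem6 (R : realType) (n : nat) (S : 'M[R]_n) (mu : 'cV[R]_n)
    (S_sym : S^T = S) (S_diag : forall i : 'I_n, S i i = 0)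
    (H : {set 'I_n}) (vH : 'cV[R]_#|H|) (vH_spin : is_spin vH) :
  (forall vQ : 'cV[R]_#|~: H|,
     minimizes (fun w : 'cV[R]_#|~: H| => is_spin w)
       (energy (submat (~: H) (~: H) S) (mu_eff S mu vH)) vQ
     <->
     minimizes (fun v : 'cV[R]_n => is_spin v /\ subvec H v = vH)
       (energy S mu) (glue vQ vH))
  /\
  (forall (tau alpha : R) (x y : 'cV[R]_n),
     0 < tau -> 0 <= alpha ->
     (forall j : 'I_n, `|x j 0| <= 1) ->
     subvec H x = vH -> subvec H y = 0 ->
     (forall k : 'I_#|H|, 0 < rho S mu vH alpha k) ->
     subvec H (bSB_step S mu tau alpha (x, y)).1 = vH /\
     subvec H (bSB_step S mu tau alpha (x, y)).2 = 0).
Proof.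
split=> [vQ | tau alpha x y tau_gt0 _ x_le1 xH yH rho_gt0].
  split=> [[vQ_spin vQ_min] | [[glue_vQ_spin _] glue_vQ_min]]; split.
  - by split; [exact: glue_spin | exact: subvec_glueH].
  - move=> w [w_spin wH].
    (* Both vectors restrict to [vH], so the same [H]-block energy appears on each side and
       cancels. *)
    rewrite !(energy_split_setC mu S_sym (vH := vH)) ?subvec_glueH //.
    by rewrite subvec_glueQ lerD2r; apply/vQ_min/subvec_spin.
  - by rewrite -(subvec_glueQ vQ vH); exact: subvec_spin.
  - move=> w w_spin.
    (* Extending w by [vH] gives an admissible competitor for the constrained problem. *)
    have := glue_vQ_min (glue w vH)
      (conj (glue_spin w_spin vH_spin) (subvec_glueH w vH)).
    rewrite !(energy_split_setC mu S_sym (vH := vH)) ?subvec_glueH //.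
    by rewrite !subvec_glueQ lerD2r.
have clip (k : 'I_#|H|) :
    let xt := x (enum_val k) 0 + tau * (y (enum_val k) 0
           + tau * ((alpha ^+ 2 - 1) * x (enum_val k) 0 + mu (enum_val k) 0
                    + (S *m x) (enum_val k) 0)) in
    1 < `|xt| /\ Num.sg xt = vH k 0.
  have -> : x (enum_val k) 0 = vH k 0 by rewrite -xH mxE.
  have -> : y (enum_val k) 0 = 0.
    by move/matrixP/(_ k 0): yH; rewrite !mxE.
  (* As y vanishes here, the displacement is tau^2 times the force; both positive factors tau are
     stripped off. *)
  apply: clip_spin => //; rewrite add0r !(mulrCA (vH k 0)).
  rewrite pmulr_rgt0 // pmulr_rgt0 //.
  exact: lt_le_trans (rho_gt0 k) (rho_le_field S mu alpha k vH_spin x_le1 xH).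
split; apply/matrixP=> k j; rewrite (ord1 j) /= !mxE.
  by have := clip k; rewrite /= !mxE => -[-> ->].
by have := clip k; rewrite /= !mxE => -[-> _].
Qed.
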